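(* There is an absolute constant $C>0$ such that the following holds. Let $n\geq2$, let $q:\mathbb{R}^n\to[0,\infty)$ be a Borel integrable function, let $a$ be a real number, and suppose that \[ \int_{\xi^\perp}q(x)\,d\lambda_{\xi^\perp}(x)\leq\frac{a}{\sqrt n}\qquad\text{for every }\xi\in\mathbb{S}^{n-1}. \] Then, for every $R>0$, \[ \int_{RB_2^n}q(x)\,dx\leq C\,\frac{aR}{n}. \]
   Context: $B_2^n$ is the Euclidean unit ball of $\mathbb{R}^n$, $\mathbb{S}^{n-1}$ the unit sphere, $\xi^\perp=\{x\in\mathbb{R}^n:\langle x,\xi\rangle=0\}$, and $\lambda_{\xi^\perp}$ is $(n-1)$-dimensional Lebesgue measure on $\xi^\perp$. ''Absolute constant'' means independent of $n$ and of all other parameters. *)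

(* Defs.v *)
From HB Require Import structures.
From mathcomp Require Import all_boot all_order all_algebra.
From mathcomp Require Import all_classical all_reals all_analysis.
From mathcomp Require Import measurable_realfun ring lra.
Set Implicit Arguments.
Unset Strict Implicit.
Unset Printing Implicit Defensive.
Import Order.TTheory GRing.Theory Num.Theory.
Import numFieldNormedType.Exports.
Local Open Scope classical_set_scope.
Local Open Scope ring_scope.

(* R^n is n.-tuple R; the library's sigma-algebra on it is the one generated
   by the coordinates, i.e. the Borel sigma-algebra. *)

Section euclidean.
Context {R : realType} {n : nat}.
Implicit Types x y : n.-tuple R.

Definition dot x y : R := \sum_(i < n) tnth x i * tnth y i.

Definition enorm x : R := Num.sqrt (dot x x).

Definition eball (r : R) : set (n.-tuple R) := [set x | enorm x <= r].

Definition usphere : set (n.-tuple R) := [set x | enorm x = 1].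

Definition perp (xi : n.-tuple R) : set (n.-tuple R) := [set x | dot x xi = 0].

End euclidean.

Definition cons_pair {R : realType} {n : nat}
  (p : measurableTypeR R * n.-tuple R) : n.+1.-tuple R := [tuple of p.1 :: p.2].

(* R^0 is a single point of mass 1, and the measure on R^(n+1) is the product
   of the measures on R and on R^n, transported along (t, y) |-> t :: y. *)
Fixpoint leb {R : realType} (n : nat) : set (n.-tuple R) -> \bar R :=
  match n return set (n.-tuple R) -> \bar R with
  | 0 => dirac [tuple]
  | m.+1 => pushforward (lebesgue_measure \x @leb R m)%E cons_pair
  end.
Arguments leb {R} n _.


Section leb_measure.
Context {R : realType}.

Lemma measurable_cons_pair n : measurable_fun setT (@cons_pair R n).
Proof. by apply: measurable_cons => //; exact: measurable_fst. Qed.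

Lemma measurable_uncons n : measurable_fun setT
  (fun x : n.+1.-tuple R =>
    (thead x, [tuple of behead x]) : (measurableTypeR R * n.-tuple R)%type).
Proof.
apply/measurable_fun_pairP; split; last exact: measurable_behead.
exact: measurable_tnth.
Qed.

Lemma bundle_sigma_finite d (T : measurableType d) (mu : set T -> \bar R) :
  mu set0 = 0%E -> (forall A, (0 <= mu A)%E) -> semi_sigma_additive mu ->
  sigma_finite setT mu ->
  exists m : {sigma_finite_measure set T -> \bar R},
    m = mu :> (set T -> \bar R).
Proof.
move=> mu0 mu_ge0 mu_sadd sf.
pose fM := isMeasure.Build d T R mu mu0 mu_ge0 mu_sadd.
pose M : measure T R := HB.pack mu fM.
pose fS := Measure_isSigmaFinite.Build d T R M sf.
pose S : sigma_finite_measure T R := HB.pack mu fM fS.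
by exists S.
Qed.

Lemma leb_sigma_finite_measure n :
  exists m : {sigma_finite_measure set (n.-tuple R) -> \bar R},
    m = @leb R n :> (set (n.-tuple R) -> \bar R).
Proof.
elim: n => [|n [m IH]].
  by exists (dirac [tuple] : {finite_measure set (0.-tuple R) -> \bar R}).
pose L : {sigma_finite_measure set (measurableTypeR R) -> \bar R} :=
  lebesgue_measure.
pose P : {measure set (measurableTypeR R * n.-tuple R)%type -> \bar R} :=
  (L \x m)%E.
pose mu := pushforward P cons_pair.
have mC := @measurable_cons_pair n.
have mu0 : mu set0 = 0%E by exact: measure0.
have mu_ge0 A : (0 <= mu A)%E by exact: measure_ge0.
have mu_sadd : semi_sigma_additive mu by exact: measure_semi_sigma_additive.
have sf : sigma_finite setT mu.
  have /sigma_finiteP[F [FT ndF Ffin]] := sigma_finiteT L.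
  have /sigma_finiteP[G [GT ndG Gfin]] := sigma_finiteT m.
  pose u (x : n.+1.-tuple R) : (measurableTypeR R * n.-tuple R)%type :=
    (thead x, [tuple of behead x]).
  have uK : u \o cons_pair = id.
    apply/funext => -[t y]; rewrite /u /cons_pair /= theadE.
    by congr pair; exact/val_inj.
  exists (fun k => u @^-1` (F k `*` G k)).
    apply/esym; rewrite -subTset => x _.
    have : [set: measurableTypeR R] (u x).1 by [].
    have : [set: n.-tuple R] (u x).2 by [].
    rewrite FT GT => -[i _ Gi] [j _ Fj]; exists (maxn i j) => //; split.
    - by move: Fj; exact/subsetPset/ndF/leq_maxr.
    - by move: Gi; exact/subsetPset/ndG/leq_maxl.
  move=> k; have [mF Ff] := Ffin k; have [mG Gf] := Gfin k; split.
    rewrite -[X in measurable X]setTI; apply: measurable_uncons => //.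
    exact: measurableX.
  rewrite /mu /pushforward -comp_preimage uK preimage_id.
  by rewrite /P/= product_measure1E// lte_mul_pinfty// ge0_fin_numE.
have [S SE] := bundle_sigma_finite mu0 mu_ge0 mu_sadd sf.
by exists S; rewrite SE /mu /P /= IH.
Qed.

Let leb0 n : leb n set0 = 0%E :> \bar R.
Proof. by have [m <-] := leb_sigma_finite_measure n; exact: measure0. Qed.

Let leb_ge0 n A : (0 <= @leb R n A)%E.
Proof. by have [m <-] := leb_sigma_finite_measure n; exact: measure_ge0. Qed.

Let leb_sigma_additive n : semi_sigma_additive (@leb R n).
Proof.
by have [m <-] := leb_sigma_finite_measure n; exact: measure_semi_sigma_additive.
Qed.

Let leb_sigma_finite n : sigma_finite setT (@leb R n).
Proof. by have [m <-] := leb_sigma_finite_measure n; exact: sigma_finiteT. Qed.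

HB.instance Definition _ n := isMeasure.Build _ _ _ (@leb R n)
  (leb0 n) (@leb_ge0 n) (@leb_sigma_additive n).
HB.instance Definition _ n := Measure_isSigmaFinite.Build _ _ _ (@leb R n)
  (leb_sigma_finite n).

End leb_measure.

Section hyperplane_measure.
Context {R : realType} {n : nat}.

(* n-1 orthonormal vectors orthogonal to xi: an orthonormal basis of the
   hyperplane perp xi when xi != 0. *)
Definition perp_onb (xi : n.-tuple R) : set (n.-1.-tuple (n.-tuple R)) :=
  [set u | (forall i j, dot (tnth u i) (tnth u j) = (i == j)%:R) /\
           (forall i, dot (tnth u i) xi = 0)].

Definition lincomb (u : n.-1.-tuple (n.-tuple R)) (y : n.-1.-tuple R) :
    n.-tuple R :=
  [tuple \sum_(j < n.-1) tnth y j * tnth (tnth u j) i | i < n].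

(* Lebesgue measure on perp xi, as a measure on R^n carried by perp xi: the
   image of the Lebesgue measure of R^(n-1) under the linear isometry given by
   an orthonormal basis of perp xi (one exists by perp_onb_neq0; the choice is
   immaterial since Lebesgue measure is invariant under isometries). *)
Definition leb_perp (xi : n.-tuple R) : set (n.-tuple R) -> \bar R :=
  pushforward (leb n.-1)
    (lincomb (xget [tuple [tuple 0 | _ < n] | _ < n.-1] (perp_onb xi))).

Lemma measurable_lincomb u : measurable_fun setT (lincomb u).
Proof.
apply/measurable_fun_tnthP => i.
rewrite (_ : _ \o _ =
  fun y => \sum_(j < n.-1) tnth y j * tnth (tnth u j) i); last first.
  by apply/funext => y /=; rewrite tnth_mktuple.
apply: measurable_sum => j.
apply: measurable_funM; last exact: measurable_cst.
exact: measurable_tnth.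
Qed.

Variable xi : n.-tuple R.

Let leb_perp0 : leb_perp xi set0 = 0%E.
Proof. by rewrite /leb_perp /pushforward preimage_set0 measure0. Qed.

Let leb_perp_ge0 A : (0 <= leb_perp xi A)%E.
Proof. by rewrite /leb_perp /pushforward; exact: measure_ge0. Qed.

Let leb_perp_sigma_additive : semi_sigma_additive (leb_perp xi).
Proof.
rewrite /leb_perp; set u := xget _ _; have mu := @measurable_lincomb u.
exact: measure_semi_sigma_additive.
Qed.

HB.instance Definition _ := isMeasure.Build _ _ _ (leb_perp xi)
  leb_perp0 leb_perp_ge0 leb_perp_sigma_additive.

End hyperplane_measure.

(* The images of the last n - 1 coordinate vectors under the reflection
   exchanging the first coordinate vector with xi. *)
Lemma perp_onb_neq0 (R : realType) (n : nat) (xi : n.-tuple R) :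
  (0 < n)%N -> usphere xi -> perp_onb xi !=set0.
Proof.
case: n xi => // n xi _ xi1.
have {xi1} xi1 : dot xi xi = 1.
  have d0 : 0 <= dot xi xi.
    by apply: sumr_ge0 => i _; rewrite -expr2 sqr_ge0.
  by rewrite -(sqr_sqrtr d0) -/(enorm xi) xi1 expr1n.
pose x0 := tnth xi ord0.
pose s j : R := tnth xi (lift ord0 j).
have sE : \sum_(j < n) s j * s j = 1 - x0 * x0.
  by move: xi1; rewrite /dot big_ord_recl => <-; rewrite addrC addKr.
(* when x0 = 1, all s j vanish and so does c *)
pose c := if x0 == 1 then 0 else (1 - x0)^-1.
have cE : c * (1 - x0) = 1 \/ (x0 = 1 /\ forall j, s j = 0).
  rewrite /c; case: eqP => [x01|/eqP x01]; last first.
    by left; rewrite mulVf// subr_eq0 eq_sym.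
  right; split => // j; move: sE; rewrite x01 mulr1 subrr.
  move/eqP; rewrite psumr_eq0; last by move=> i _; rewrite -expr2 sqr_ge0.
  by move/allP/(_ j (mem_index_enum j)); rewrite mulf_eq0 orbb => /eqP.
pose U := [tuple [tuple (i == lift ord0 j)%:R
                   - c * s j * (tnth xi i - (i == ord0)%:R) | i < n.+1] | j < n].
have U0 j : tnth (tnth U j) ord0 = c * s j * (1 - x0).
  by rewrite !tnth_mktuple eqxx (negbTE (neq_lift _ _)) /= -/x0; ring.
have US j k : tnth (tnth U j) (lift ord0 k) = (k == j)%:R - c * s j * s k.
  rewrite !tnth_mktuple (inj_eq lift_inj) [lift _ _ == _]eq_sym.
  by rewrite (negbTE (neq_lift _ _)) subr0.
have sumd j (f : 'I_n -> R) : \sum_(k < n) (k == j)%:R * f k = f j.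
  rewrite (bigD1 j)//= eqxx mul1r big1 ?addr0// => k /negbTE ->.
  by rewrite mul0r.
exists U; split => [i j|i].
- rewrite /dot big_ord_recl !U0.
  under eq_bigr do rewrite !US.
  rewrite (eq_bigr (fun k => (k == i)%:R * (k == j)%:R
     - c * s j * ((k == i)%:R * s k) - c * s i * ((k == j)%:R * s k)
     + c * c * s i * s j * (s k * s k))); last by move=> k _; ring.
  rewrite big_split !sumrB -!mulr_sumr sE !sumd /=.
  case: cE => [cE|[-> s0]]; last by rewrite !s0 eq_sym; ring.
  rewrite eq_sym; set d := (_ == _)%:R.
  transitivity (d + c * s i * s j * (c * (1 - x0) - 1) *+ 2); first by ring.
  by rewrite cE subrr mulr0 mul0rn addr0.
- rewrite /dot big_ord_recl U0 -/x0.
  under eq_bigr do rewrite US.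
  rewrite (eq_bigr (fun k => (k == i)%:R * s k - c * s i * (s k * s k)));
    last by move=> k _; rewrite -/(s k); ring.
  rewrite sumrB -mulr_sumr sE sumd.
  case: cE => [cE|[-> s0]]; last by rewrite !s0; ring.
  transitivity (s i * (1 - c * (1 - x0))); first by ring.
  by rewrite cE subrr mulr0.
Qed.

(* Main.v *)
(* Writing the measure delta(<u, x>) du dx on pairs of orthogonal vectors of R^n
   in two ways, by eliminating the first coordinate of x or that of u, gives
     int e^(-|u|^2) (int_(u^perp) q) du
       = int q(x) / |x| (int_(x^perp) |u| e^(-|u|^2) du) dx.
   The left-hand side is at most pi^(n/2) a / sqrt n, and the inner integral on
   the right is of order sqrt n pi^(n/2), so that int q(x) / |x| dx is at most a
   constant times a / n.  The two coordinate systems are exchanged by the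
   invariance of dt/|t| under t |-> c/t, so no integration over the sphere or
   over the rotation group is needed. *)
Require Import Defs.
From mathcomp Require Import all_boot all_order all_algebra.
From mathcomp Require Import all_classical all_reals all_analysis.
From mathcomp Require Import measurable_realfun ring lra.
Import Order.TTheory GRing.Theory Num.Theory.
Import numFieldNormedType.Exports.
Local Open Scope classical_set_scope.
Local Open Scope ring_scope.
Set Implicit Arguments.
Unset Strict Implicit.
Unset Printing Implicit Defensive.

(** [leb_perp] is defined through a chosen orthonormal basis, whereas the two coordinate systems
    only see products of one-dimensional measures. The link is to describe a hyperplane with normal
    [(1, w)] as a graph over the last coordinates, with area factor [sqrt (1 + |w|^2)]. That factor
    comes from the uniqueness of translation-invariant measures, normalized by one Gaussian
    integral, so no determinant and no change of variables in several dimensions is needed. The same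
    identity ([integral_lincomb]) serves both sides: on the left it turns the graph integral back
    into an integral over [u^perp], on the right it shows that the Gaussian moment of [x^perp] is
    the same for every [x]. Hyperplanes containing the first coordinate vector are not graphs; they
    correspond to a vanishing first coordinate [t], a null set on which the convention [0^-1 = 0]
    makes the integrands zero. *)

(** * Affine substitution and null points on the real line *)

Section affine.
Context {R : realType}.
Local Notation mu := (@lebesgue_measure R).

Lemma measurable_affine (a b : R) :
  measurable_fun [set: measurableTypeR R] (fun t => a * t + b : measurableTypeR R).
Proof. by apply: measurable_funD => //; exact: measurable_funM. Qed.

(** The image of Lebesgue measure under [a * t + b], multiplied by [|a|], gives every interval []c,
    d]] its length, so it is Lebesgue measure by uniqueness. *)
Lemma ge0_integral_affine (a b : R) (f : R -> \bar R) : a != 0 ->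
  measurable_fun setT f -> (forall t, 0 <= f t)%E ->
  (\int[mu]_t f (a * t + b)%R = `|a|^-1%:E * \int[mu]_t f t)%E.
Proof.
move=> a0 mf f0.
have na0 : 0 < `|a| by rewrite normr_gt0.
pose phi t : measurableTypeR R := a * t + b.
have mphi : measurable_fun setT phi by exact: measurable_affine.
pose P0 : {measure set (measurableTypeR R) -> \bar R} := pushforward mu phi.
pose P := P0 mphi.
pose k : {nonneg R} := NngNum (ltW na0).
have muE A : measurable A -> mu A = mscale k P A.
  apply: lebesgue_measure_unique => _ [[c d] _ <-] /=.
  rewrite /mscale /= /pushforward.
  (* The maximum with 0 covers the empty intervals, [d <= c]. For [a < 0] the preimage is closed on
     the left and open on the right. *)
  have : mu (phi @^-1` `]c, d]) = (Num.max 0 (`|a|^-1 * (d - c)))%:E.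
    have [a_gt0|a_le0] := ltP 0 a.
      rewrite (_ : phi @^-1` _ = `](c - b) / a, (d - b) / a]%classic).
        rewrite lebesgue_measure_itv /= lte_fin ltr_pM2r ?invr_gt0//.
        rewrite ltrBlDr subrK gtr0_norm//.
        case: ltP => cd; last first.
          by rewrite max_l// pmulr_rle0 ?invr_gt0// subr_le0.
        rewrite max_r; last by rewrite pmulr_rge0 ?invr_gt0// subr_ge0 ltW.
        by rewrite -EFinB; congr EFin; field.
      apply/seteqP; split => t; rewrite /phi /= !in_itv/=.
        by rewrite ltr_pdivrMr// ler_pdivlMr// ltrBlDr lerBrDr mulrC.
      by rewrite ltr_pdivrMr// ler_pdivlMr// ltrBlDr lerBrDr mulrC.
    have a_lt0 : a < 0 by rewrite lt_neqAle a0.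
    rewrite (_ : phi @^-1` _ = `[(d - b) / a, (c - b) / a[%classic).
      rewrite lebesgue_measure_itv /= lte_fin ltr_nM2r ?invr_lt0//.
      rewrite ltrBlDr subrK ltr0_norm//.
      have aV : 0 < (- a)^-1 by rewrite invr_gt0 oppr_gt0.
      case: ltP => cd; last by rewrite max_l// pmulr_rle0// subr_le0.
      rewrite max_r; last by rewrite pmulr_rge0// subr_ge0 ltW.
      by rewrite -EFinB; congr EFin; field.
    apply/seteqP; split => t; rewrite /phi /= !in_itv/=.
      by rewrite ler_ndivrMr// ltr_ndivlMr// lerBrDr ltrBlDr mulrC andbC.
    by rewrite ler_ndivrMr// ltr_ndivlMr// lerBrDr ltrBlDr mulrC andbC.
  move=> ->; rewrite lebesgue_measure_itv /= lte_fin.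
  rewrite -EFinM maxr_pMr ?normr_ge0// mulr0 mulrA divff ?gt_eqF// mul1r.
  case: ltP => cd; first by rewrite max_r ?subr_ge0 1?ltW// -EFinB.
  by rewrite max_l// subr_le0.
rewrite [in RHS](eq_measure_integral (mscale k P)); last first.
  by move=> A mA _; exact: muE.
rewrite ge0_integral_mscale//= ge0_integral_pushforward//= preimage_setT.
rewrite muleA -EFinM mulVf ?mul1e// gt_eqF//.
Qed.

(** Used to discard the single value of a coordinate at which a division degenerates. *)
Lemma ge0_eq_integral_off_point (p : R) (f g : R -> \bar R) :
  measurable_fun setT f -> measurable_fun setT g ->
  (forall t, 0 <= f t)%E -> (forall t, 0 <= g t)%E ->
  (forall t, t != p -> f t = g t) ->
  (\int[mu]_t f t = \int[mu]_t g t)%E.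
Proof.
move=> mf mg f0 g0 fg.
rewrite -(@integral_setD1 _ f p)//; last 2 first.
- exact: measurableD.
- exact: measurable_funTS.
rewrite -[RHS](@integral_setD1 _ g p)//; last 2 first.
- exact: measurableD.
- exact: measurable_funTS.
by apply: eq_integral => t; rewrite inE /= => -[_ /eqP] /fg.
Qed.

End affine.

(** * Operations on tuples and closure properties of measurability *)

Definition tcons {R : realType} n (t : R) (y : n.-tuple R) : n.+1.-tuple R :=
  [tuple of t :: y].

Definition tadd {R : realType} n (x y : n.-tuple R) :=
  [tuple tnth x i + tnth y i | i < n].

Definition topp {R : realType} n (x : n.-tuple R) := [tuple - tnth x i | i < n].

(* [x |-> graph w x] parametrizes the hyperplane orthogonal to [(1, w)]. *)
Definition graph {R : realType} n (w x : n.-tuple R) : n.+1.-tuple R :=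
  tcons (- dot w x) x.

Section measurability.
Context {R : realType} d {T : measurableType d}.

(** Inversion is not continuous at 0; writing [y^-1 = y * (y^2)^-1] reduces it to a power function
    on nonnegative reals, and the factor [y] gives the value 0 at 0. *)
Lemma measurable_funV (f : T -> R) :
  measurable_fun setT f -> measurable_fun setT (fun x => (f x)^-1).
Proof.
move=> mf; rewrite (_ : (fun _ => _) = fun x => f x * (f x ^+ 2) `^ (-1)).
  apply: measurable_funM => //.
  apply: (@measurableT_comp _ _ _ _ _ _ (fun y => y `^ (-1))) => //.
  exact: measurable_funX.
apply/funext => x; rewrite powR_inv1 ?sqr_ge0//.
have [->|fx0] := eqVneq (f x) 0; first by rewrite invr0 mul0r.
by field.
Qed.

Lemma measurable_fun_sqrt (f : T -> R) :
  measurable_fun setT f -> measurable_fun setT (fun x => Num.sqrt (f x)).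
Proof.
move=> mf; apply: (@measurableT_comp _ _ _ _ _ _ (@Num.sqrt R)) => //.
by apply: continuous_measurable_fun; exact: sqrt_continuous.
Qed.

Lemma measurable_mktuple n (f : 'I_n -> T -> R) :
  (forall i, measurable_fun setT (f i)) ->
  measurable_fun setT (fun x => [tuple f i x | i < n]).
Proof.
move=> mf; apply/measurable_fun_tnthP => i.
rewrite (_ : _ \o _ = f i)//; apply/funext => x /=.
by rewrite tnth_mktuple.
Qed.

Lemma measurable_fun_tnth n (f : T -> n.-tuple R) i :
  measurable_fun setT f -> measurable_fun setT (fun x => tnth (f x) i).
Proof. by move=> mf; exact: (measurableT_comp (measurable_tnth i) mf). Qed.

Lemma measurable_fun_dot n (f g : T -> n.-tuple R) :
  measurable_fun setT f -> measurable_fun setT g ->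
  measurable_fun setT (fun x => dot (f x) (g x)).
Proof.
move=> mf mg; apply: measurable_sum => i.
by apply: measurable_funM; exact: measurable_fun_tnth.
Qed.

Lemma measurable_fun_behead n (f : T -> n.+1.-tuple R) :
  measurable_fun setT f ->
  measurable_fun setT (fun x => [tuple of behead (f x)]).
Proof.
move=> mf; apply: (@measurableT_comp _ _ _ _ _ _
  (fun y : n.+1.-tuple R => [tuple of behead y]) _ _ _ mf).
exact: measurable_behead.
Qed.

Lemma measurable_fun_tcons n (f : T -> R) (g : T -> n.-tuple R) :
  measurable_fun setT f -> measurable_fun setT g ->
  measurable_fun setT (fun x => tcons (f x) (g x)).
Proof. by move=> mf mg; exact: measurable_cons. Qed.

Lemma measurable_fun_tadd n (f g : T -> n.-tuple R) :
  measurable_fun setT f -> measurable_fun setT g ->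
  measurable_fun setT (fun x => tadd (f x) (g x)).
Proof.
move=> mf mg; apply: measurable_mktuple => i.
by apply: measurable_funD; exact: measurable_fun_tnth.
Qed.

Lemma measurable_fun_topp n (f : T -> n.-tuple R) :
  measurable_fun setT f -> measurable_fun setT (fun x => topp (f x)).
Proof.
move=> mf; apply: measurable_mktuple => i.
by apply: measurable_funN; exact: measurable_fun_tnth.
Qed.

Lemma measurable_fun_graph n (f g : T -> n.-tuple R) :
  measurable_fun setT f -> measurable_fun setT g ->
  measurable_fun setT (fun x => graph (f x) (g x)).
Proof.
move=> mf mg; apply: measurable_fun_tcons => //.
by apply: measurable_funN; exact: measurable_fun_dot.
Qed.

End measurability.

Lemma measurable_inv (R : realType) : measurable_fun [set: R] (@GRing.inv R).
Proof. by apply: (@measurable_funV _ _ _ id); exact: measurable_id. Qed.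

Lemma measurable_sqrt (R : realType) : measurable_fun [set: R] (@Num.sqrt R).
Proof. by apply: (@measurable_fun_sqrt _ _ _ id); exact: measurable_id. Qed.

Lemma measurable_fun_integral (R : realType) d1 d2 (T1 : measurableType d1)
    (T2 : measurableType d2) (m2 : {sigma_finite_measure set T2 -> \bar R})
    (f : T1 -> T2 -> \bar R) :
  measurable_fun setT (fun z : T1 * T2 => f z.1 z.2) ->
  (forall x y, (0 <= f x y)%E) ->
  measurable_fun setT (fun x => \int[m2]_y f x y)%E.
Proof.
move=> mf f0.
exact: (measurable_fun_fubini_tonelli_F (fun z : T1 * T2 => f z.1 z.2)).
Qed.

Lemma ge0_exchange_integral (R : realType) d1 d2 (T1 : measurableType d1)
    (T2 : measurableType d2) (m1 : {sigma_finite_measure set T1 -> \bar R})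
    (m2 : {sigma_finite_measure set T2 -> \bar R})
    (f : T1 -> T2 -> \bar R) :
  measurable_fun setT (fun z : T1 * T2 => f z.1 z.2) ->
  (forall x y, (0 <= f x y)%E) ->
  (\int[m1]_x \int[m2]_y f x y = \int[m2]_y \int[m1]_x f x y)%E.
Proof.
move=> mf f0.
exact: (fubini_tonelli (fun z : T1 * T2 => f z.1 z.2)).
Qed.

(** Recursion on the shape of the function. The difference pattern precedes the sum pattern, which
    would also match it; the patterns with a partially applied head, such as [GRing.mul _], catch
    eta-contracted functions. *)
Ltac meas := first
  [ assumption | lazymatch goal with
  | |- measurable_fun _ (fun _ => ?c) => exact: measurable_cst
  | |- measurable_fun _ (fun x => x) => exact: measurable_id
  | |- measurable_fun _ (fun x => fst x) => exact: measurable_fst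
  | |- measurable_fun _ (fun x => snd x) => exact: measurable_snd
  | |- measurable_fun _ (fun x => fst (@?f x)) =>
      apply: (measurableT_comp measurable_fst); meas
  | |- measurable_fun _ (fun x => snd (@?f x)) =>
      apply: (measurableT_comp measurable_snd); meas
  | |- measurable_fun _ (fun x => EFin (@?f x)) =>
      apply/measurable_EFinP; meas
  | |- measurable_fun _ (fun x => mule (@?f x) (@?g x)) =>
      apply: emeasurable_funM; meas
  | |- measurable_fun _ (fun x => GRing.mul (@?f x) (@?g x)) =>
      apply: measurable_funM; meas
  | |- measurable_fun _ (fun x => GRing.inv (@?f x)) =>
      apply: (@measurable_funV _ _ _ f); meas
  | |- measurable_fun _ (fun x => GRing.add (@?f x) (GRing.opp (@?g x))) =>
      apply: measurable_funB; meas
  | |- measurable_fun _ (fun x => GRing.add (@?f x) (@?g x)) =>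
      apply: measurable_funD; meas
  | |- measurable_fun _ (fun x => GRing.opp (@?f x)) =>
      apply: measurable_funN; meas
  | |- measurable_fun _ (fun x => GRing.exp (@?f x) _) =>
      apply: measurable_funX; meas
  | |- measurable_fun _ (fun x => Num.sqrt (@?f x)) =>
      apply: measurable_fun_sqrt; meas
  | |- measurable_fun _ (fun x => Num.norm (@?f x)) =>
      apply: (measurableT_comp (@normr_measurable _ setT)); meas
  | |- measurable_fun _ (fun x => expR (@?f x)) =>
      apply: (measurableT_comp (@measurable_expR _)); meas
  | |- measurable_fun _ (fun x => dot (@?f x) (@?g x)) =>
      apply: measurable_fun_dot; meas
  | |- measurable_fun _ (fun x => tnth (@?f x) _) =>
      apply: measurable_fun_tnth; meas
  | |- measurable_fun _ (fun x => mktuple (@?f x)) =>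
      apply: measurable_mktuple => ?; meas
  | |- measurable_fun _ (fun x => tcons (@?f x) (@?g x)) =>
      apply: measurable_fun_tcons; meas
  | |- measurable_fun _ (fun x => [tuple of behead (@?f x)]) =>
      apply: measurable_fun_behead; meas
  | H : measurable_fun _ ?h |- measurable_fun _ (fun x => ?h (@?f x)) =>
      apply: (measurableT_comp H (g := f)); meas
  | |- measurable_fun _ (fun x => tadd (@?f x) (@?g x)) =>
      apply: measurable_fun_tadd; meas
  | |- measurable_fun _ (fun x => topp (@?f x)) =>
      apply: measurable_fun_topp; meas
  | |- measurable_fun _ (fun x => graph (@?f x) (@?g x)) =>
      apply: measurable_fun_graph; meas
  | |- measurable_fun _ (GRing.mul _) =>
      apply: measurable_funM; [exact: measurable_cst|exact: measurable_id]
  | |- measurable_fun _ (GRing.add _) =>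
      apply: measurable_funD; [exact: measurable_cst|exact: measurable_id]
  | |- measurable_fun _ (dot _) =>
      apply: measurable_fun_dot; [exact: measurable_cst|exact: measurable_id]
  | |- measurable_fun _ (tcons _) =>
      apply: measurable_fun_tcons; [exact: measurable_cst|exact: measurable_id]
  | |- measurable_fun _ (graph _) =>
      apply: measurable_fun_graph; [exact: measurable_cst|exact: measurable_id]
  | |- measurable_fun _ (EFin \o _) => apply/measurable_EFinP; meas
  | |- measurable_fun _ (@GRing.inv _) => exact: measurable_inv
  | |- measurable_fun _ (@Num.sqrt _) => exact: measurable_sqrt
  | _ => try by []
  end | idtac ].

(** * Scaling and inversion invariance of [dt/|t|] *)

Section hyperbola.
Context {R : realType}.
Local Notation mu := (@lebesgue_measure R).
Local Open Scope ereal_scope.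

Let ge0_integral_haar_scale (a : R) (h : R -> \bar R) : a != 0%R ->
  measurable_fun setT h -> (forall t, 0 <= h t) ->
  \int[mu]_t (`|t|^-1%:E * h (a * t)%R) = \int[mu]_t (`|t|^-1%:E * h t).
Proof.
move=> a0 mh h0.
pose k t := `|t|^-1%:E * h t.
transitivity (\int[mu]_t (`|a|%:E * k (a * t + 0)%R)).
  apply: eq_integral => t _; rewrite addr0 /k muleA -EFinM normrM invfM.
  by rewrite mulrA mulfV ?mul1r// normr_eq0.
have mk : measurable_fun setT k by rewrite /k; meas.
have k0 t : 0 <= k t by rewrite /k mule_ge0// lee_fin.
rewrite ge0_integralZl//=; last exact: (measurableT_comp mk (measurable_affine _ _)).
rewrite ge0_integral_affine// muleA -EFinM mulfV ?mul1e// normr_eq0//.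
Qed.

(* [dt/|t|] is invariant under scaling; integrating [h (c/t) g (t s)] against
   [dt/|t| ds/|s|] in both orders then gives the invariance under inversion. *)
Lemma ge0_integral_haar_inv (c : R) (h : R -> \bar R) : c != 0%R ->
  measurable_fun setT h -> (forall t, 0 <= h t) ->
  \int[mu]_t (`|t|^-1%:E * h (c / t)%R) = \int[mu]_t (`|t|^-1%:E * h t).
Proof.
move=> c0 mh h0.
(* [g] has mass 1 for [dt/|t|], so it can be introduced at the start and integrated out at the
   end. *)
pose g (t : R) : R := (`|t| * \1_`[0%R, 1%R] t)%R.
have mg : measurable_fun setT g.
  apply: measurable_funM => //.
have n0 (t : R) : 0 <= `|t|^-1%:E :> \bar R by rewrite lee_fin.
have g0 t : 0 <= (g t)%:E by rewrite lee_fin mulr_ge0.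
have g1 : \int[mu]_t (`|t|^-1%:E * (g t)%:E) = 1.
  rewrite (@ge0_eq_integral_off_point _ 0%R _ (fun t => (\1_`[0%R, 1%R] t)%:E))//.
  - rewrite integral_indic// setIT /= lebesgue_measure_itv/= lte_fin ltr01.
    by rewrite -EFinB subr0.
  - meas.
  - by apply/measurable_EFinP; exact: measurable_indic.
  - by move=> t; rewrite mule_ge0.
  - by move=> t t0; rewrite -EFinM mulrA mulVf ?mul1r// normr_eq0.
pose F t s := `|t|^-1%:E * h (c / t)%R * (`|s|^-1%:E * (g (t * s)%R)%:E).
transitivity (\int[mu]_t \int[mu]_s F t s).
  apply: eq_integral => t _; rewrite /F ge0_integralZl//; last 3 first.
  - meas.
  - by move=> x _; rewrite mule_ge0.
  - by rewrite mule_ge0.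
  have [->|t0] := eqVneq t 0%R; first by rewrite normr0 invr0 !mul0e.
  rewrite (ge0_integral_haar_scale (h := EFin \o g))//= ?g1 ?mule1//.
  meas.
transitivity (\int[mu]_s \int[mu]_t F t s).
  apply: (@ge0_exchange_integral _ _ _ _ _ mu mu F).
    by rewrite /F; meas.
  by move=> t s; rewrite /F !mule_ge0.
pose G s t := `|t|^-1%:E * (g t)%:E * (`|s|^-1%:E * h (c / t * s)%R).
transitivity (\int[mu]_s \int[mu]_t G s t).
  apply: eq_integral => s _.
  have [->|s0] := eqVneq s 0%R.
    rewrite /F /G !integral0_eq// => t _; rewrite normr0 invr0 mul0e mule0//.
  (* With [c / t] written as [c / (s * t) * s], the factors [h] and [g] depend on [t] through
     [s * t] only; scaling in [t] then frees [g] of [s] and leaves [s] as a multiplier in the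
     argument of [h]. *)
  transitivity (`|s|^-1%:E *
      \int[mu]_t (`|t|^-1%:E * (h (c / (s * t) * s)%R * (g (s * t)%R)%:E))).
    rewrite -ge0_integralZl//; last 2 first.
    - meas.
    - by move=> t _; rewrite !mule_ge0.
    apply: eq_integral => t _.
    rewrite /F [(t * s)%R]mulrC muleCA -muleA.
    by rewrite (_ : c / (s * t) * s = c / t)%R// invfM mulrA mulrAC mulfVK.
  rewrite (ge0_integral_haar_scale
    (h := fun t => h (c / t * s)%R * (g t)%:E))//; last 2 first.
  - meas.
  - by move=> t; rewrite mule_ge0.
  rewrite -ge0_integralZl//; last 2 first.
  - meas.
  - by move=> t _; rewrite !mule_ge0.
  apply: eq_integral => t _.
  by rewrite /G [RHS]muleCA -muleA [in RHS](muleC (g t)%:E).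
transitivity (\int[mu]_t \int[mu]_s G s t).
  apply: (@ge0_exchange_integral _ _ _ _ _ mu mu G).
    by rewrite /G; meas.
  by move=> s t; rewrite /G !mule_ge0.
rewrite -[RHS]mul1e -g1 -ge0_integralZr//; last 3 first.
- meas.
- by move=> t _; rewrite mule_ge0.
- by apply: integral_ge0 => t _; rewrite mule_ge0.
apply: eq_integral => t _; rewrite /G ge0_integralZl//; last 3 first.
- meas.
- by move=> s _; rewrite mule_ge0.
- by rewrite mule_ge0.
have [->|t0] := eqVneq t 0%R; first by rewrite normr0 invr0 !mul0e.
rewrite ge0_integral_haar_scale// mulf_neq0// invr_neq0//.
Qed.
End hyperbola.

(** * Algebra of the inner product *)

Section tuples.
Context {R : realType}.

Lemma tadd_cons n t s (x y : n.-tuple R) :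
  tadd (tcons t x) (tcons s y) = (tcons (t + s) (tadd x y)).
Proof.
apply: eq_from_tnth => i; rewrite tnth_mktuple.
by case: (unliftP ord0 i) => [j|] ->; rewrite ?tnthS ?tnth0// tnth_mktuple.
Qed.

Lemma behead_tadd n (x y : n.+1.-tuple R) :
  [tuple of behead (tadd x y)] = tadd [tuple of behead x] [tuple of behead y].
Proof.
by apply: eq_from_tnth => i; rewrite tnth_mktuple !tnth_behead tnth_mktuple.
Qed.

Lemma dotC n (x y : n.-tuple R) : dot x y = dot y x.
Proof. by apply: eq_bigr => i _; rewrite mulrC. Qed.

Lemma dotNr n (x y : n.-tuple R) : dot x (topp y) = - dot x y.
Proof.
by rewrite /dot -sumrN; apply: eq_bigr => i _; rewrite tnth_mktuple mulrN.
Qed.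

Lemma dotNN n (x : n.-tuple R) : dot (topp x) (topp x) = dot x x.
Proof. by rewrite dotNr dotC dotNr opprK. Qed.

Lemma dot_cons n t s (x y : n.-tuple R) :
  dot (tcons t x) (tcons s y) = t * s + dot x y.
Proof.
rewrite /dot big_ord_recl !tnth0; congr (_ + _).
by apply: eq_bigr => i _; rewrite !tnthS.
Qed.

Lemma dot_ge0 n (x : n.-tuple R) : 0 <= dot x x.
Proof. by apply: sumr_ge0 => i _; rewrite -expr2 sqr_ge0. Qed.

End tuples.

(** * Lebesgue measure on [R^n]: slicing, translations, uniqueness *)

Section leb.
Context {R : realType}.
Local Notation mu := (@lebesgue_measure R).
Local Open Scope ereal_scope.

Lemma measurable_fun_cons2 n (f : n.+1.-tuple R -> \bar R) :
  measurable_fun setT f ->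
  measurable_fun setT
    (fun z : n.-tuple R * measurableTypeR R => f (tcons z.2 z.1)).
Proof.
move=> mf; apply: (measurableT_comp mf (g := fun z => tcons z.2 z.1)).
exact: measurable_fun_tcons.
Qed.

Lemma integral_leb_cons n (f : n.+1.-tuple R -> \bar R) :
  measurable_fun setT f -> (forall x, 0 <= f x) ->
  \int[leb n.+1]_x f x = \int[leb n]_y \int[mu]_t f (tcons t y).
Proof.
move=> mf f0.
have mc := @measurable_cons_pair R n.
transitivity (\int[pushforward (mu \x leb n) cons_pair]_x f x); first by [].
rewrite ge0_integral_pushforward//= preimage_setT fubini_tonelli2//=.
by apply: measurableT_comp.
Qed.

Lemma integral_leb_translate n (v : n.-tuple R) (f : n.-tuple R -> \bar R) :
  measurable_fun setT f -> (forall x, 0 <= f x) ->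
  \int[leb n]_x f (tadd x v) = \int[leb n]_x f x.
Proof.
elim: n v f => [|n IH] v f mf f0.
  by apply: eq_integral => x _; congr f; rewrite [LHS]tuple0 [RHS]tuple0.
rewrite !integral_leb_cons//; last first.
  apply: (measurableT_comp mf (g := fun x => tadd x v)).
  by apply: measurable_fun_tadd.
pose F y := \int[mu]_t f (tcons t y).
have mF : measurable_fun setT F.
  apply: measurable_fun_integral => //.
  exact: (measurable_fun_cons2 mf).
rewrite -/(F _) -(IH [tuple of behead v] F)//; last first.
  by move=> y; exact: integral_ge0.
apply: eq_integral => y _; rewrite /F.
case/tupleP: v => s z.
have -> : [tuple of behead (tcons s z)] = z by exact/val_inj.
under eq_integral do rewrite tadd_cons -[X in (X + s)%R]mul1r.
rewrite (@ge0_integral_affine _ _ _ (fun t => f (tcons t (tadd y z))))//.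
- by rewrite normr1 invr1 mul1e.
- apply: (measurableT_comp mf (g := fun t : R => (tcons t (tadd y z)))).
  by apply: measurable_cons.
Qed.

(* The uniqueness of translation-invariant measures, for the image of [leb n]
   under [T]: both sides equal the double integral of
   [f (T y + x) * g (- T y)]. *)
Lemma integral_leb_equivariant n (T S : n.-tuple R -> n.-tuple R)
    (f g : n.-tuple R -> \bar R) :
  measurable_fun setT T -> (forall x y, T (tadd y (S x)) = tadd (T y) x) ->
  measurable_fun setT f -> measurable_fun setT g ->
  (forall x, 0 <= f x) -> (forall x, 0 <= g x) ->
  \int[leb n]_y f (T y) * \int[leb n]_x g x =
  \int[leb n]_x f x * \int[leb n]_y g (topp (T y)).
Proof.
move=> mT TS mf mg f0 g0.
have mfT : measurable_fun setT (f \o T) by exact: measurableT_comp.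
have mgT : measurable_fun setT (fun y => g (topp (T y))).
  apply: (measurableT_comp mg (g := fun y => topp (T y))).
  exact: measurable_fun_topp.
have mtr v : measurable_fun setT (fun x : n.-tuple R => tadd x v).
  exact: measurable_fun_tadd.
transitivity (\int[leb n]_y \int[leb n]_x (f (T y) * g (tadd x (topp (T y))))).
  rewrite -ge0_integralZr//; last exact: integral_ge0.
  apply: eq_integral => y _; rewrite ge0_integralZl//.
    by rewrite integral_leb_translate.
  exact: (measurableT_comp mg (mtr _)).
transitivity (\int[leb n]_x \int[leb n]_y (f (T y) * g (tadd x (topp (T y))))).
  apply: ge0_exchange_integral; last by move=> x y; rewrite mule_ge0.
  apply: emeasurable_funM.
    exact: (measurableT_comp mfT measurable_fst).
  apply: (measurableT_comp mg (g := fun z => tadd z.2 (topp (T z.1)))).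
  apply: measurable_fun_tadd; first exact: measurable_snd.
  apply: measurable_fun_topp.
  exact: (measurableT_comp mT measurable_fst).
(* Translating [y] by [S x] adds [x] to [T y]: the [x] inside [g] cancels and reappears inside
   [f]. *)
transitivity (\int[leb n]_x \int[leb n]_y (f (tadd (T y) x) * g (topp (T y)))).
  apply: eq_integral => x _.
  rewrite -(@integral_leb_translate _ (S x)) => [||y]; last by rewrite mule_ge0.
    apply: eq_integral => y _; rewrite TS; congr (_ * g _).
    by apply: eq_from_tnth => i; rewrite !tnth_mktuple; ring.
  apply: emeasurable_funM => //.
  apply: (measurableT_comp mg (g := fun y => tadd x (topp (T y)))).
  by apply: measurable_fun_tadd => //; exact: measurable_fun_topp.
transitivity (\int[leb n]_y \int[leb n]_x (f (tadd (T y) x) * g (topp (T y)))).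
  apply: ge0_exchange_integral; last by move=> x y; rewrite mule_ge0.
  apply: emeasurable_funM.
    apply: (measurableT_comp mf (g := fun z => tadd (T z.2) z.1)).
    apply: measurable_fun_tadd => //.
    exact: (measurableT_comp mT measurable_snd).
  exact: (measurableT_comp mgT measurable_snd).
rewrite -ge0_integralZl//; last exact: integral_ge0.
apply: eq_integral => y _; rewrite ge0_integralZr//.
  congr (_ * _); rewrite -[RHS](@integral_leb_translate _ (T y))//.
  apply: eq_integral => x _; congr f.
  by apply: eq_from_tnth => i; rewrite !tnth_mktuple addrC.
apply: (measurableT_comp mf (g := fun x => tadd (T y) x)).
by apply: measurable_fun_tadd.
Qed.

End leb.

(** * Gaussian integrals of a rank-one perturbation of the Euclidean form *)

Section gauss.
Context {R : realType}.
Local Notation mu := (@lebesgue_measure R).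

Lemma integral_gauss_affine (b s w : R) : 0 <= b ->
  (\int[mu]_t (expR (- (t ^+ 2 + b * (s + w * t) ^+ 2)))%:E =
   (Num.sqrt pi / Num.sqrt (1 + b * w ^+ 2) *
    expR (- (b / (1 + b * w ^+ 2) * s ^+ 2)))%:E)%E.
Proof.
move=> b0; set D := 1 + b * w ^+ 2.
have D0 : 0 < D by rewrite ltr_pwDl// mulr_ge0// sqr_ge0.
set r := Num.sqrt D; have r0 : 0 < r by rewrite sqrtr_gt0.
have r2 : r ^+ 2 = D by rewrite sqr_sqrtr// ltW.
pose e := expR (- (b / D * s ^+ 2)).
(* Completing the square: [t^2 + b (s + w t)^2 = (r t + b s w / r)^2 + (b / D) s^2], where
   [r^2 = D]. *)
transitivity (\int[mu]_t (e%:E * (gauss_fun (r * t + b * s * w / r))%:E))%E.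
  apply: eq_integral => t _; rewrite -EFinM -expRD; congr (expR _)%:E.
  rewrite [in RHS]sqrrD !exprMn exprVn r2.
  have -> : r * t * (b * s * w / r) = t * (b * s * w).
    by field; rewrite gt_eqF.
  by rewrite /D; field; rewrite -/D gt_eqF.
have mg : measurable_fun setT (fun t : R => (gauss_fun t)%:E).
  by apply/measurable_EFinP; exact: measurable_gauss_fun.
have g0 (t : R) : (0 <= (gauss_fun t)%:E)%E by rewrite lee_fin gauss_fun_ge0.
rewrite ge0_integralZl//=; last 2 first.
- exact: (measurableT_comp mg (measurable_affine _ _)).
- by rewrite lee_fin expR_ge0.
rewrite (@ge0_integral_affine _ _ _ (fun t => (gauss_fun t)%:E))//; last first.
  by rewrite gt_eqF.
by rewrite integralT_gauss -!EFinM gtr0_norm// mulrC [_^-1 * _]mulrC.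
Qed.

Lemma dot0 (x y : 0.-tuple R) : dot x y = 0.
Proof. by rewrite /dot big_ord0. Qed.

(* The quadratic form of the exponent is split off one coordinate at a time:
   completing the square in the first coordinate turns [b] into
   [b / (1 + b * w_0 ^ 2)]. *)
Lemma integral_leb_gauss n (w : n.-tuple R) (b s : R) : 0 <= b ->
  (\int[leb n]_x (expR (- (dot x x + b * (s + dot w x) ^+ 2)))%:E =
   (Num.sqrt pi ^+ n / Num.sqrt (1 + b * dot w w) *
    expR (- (b / (1 + b * dot w w) * s ^+ 2)))%:E)%E.
Proof.
elim: n w b s => [|n IH] w b s b0.
  have c x : expR (- (dot x x + b * (s + dot w x) ^+ 2)) = expR (- (b * s ^+ 2)).
    by rewrite !dot0 addr0 add0r.
  under eq_integral do rewrite c.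
  rewrite integral_cst//= diracT mule1 dot0.
  by rewrite mulr0 addr0 sqrtr1 divr1 mul1r divr1.
rewrite integral_leb_cons; last 2 first.
- by meas.
- by move=> x; rewrite lee_fin expR_ge0.
case/tupleP: w => p z; rewrite -/(tcons p z) dot_cons.
have zz := dot_ge0 z; have pp := sqr_ge0 p.
pose D := 1 + b * p ^+ 2.
have D0 : 0 < D by rewrite ltr_pwDl// mulr_ge0.
pose b' := b / D.
have b'0 : 0 <= b' by rewrite divr_ge0// ltW.
pose k := Num.sqrt pi / Num.sqrt D.
have k0 : 0 <= k by rewrite divr_ge0// sqrtr_ge0.
transitivity (\int[leb n]_y
  (k%:E * (expR (- (dot y y + b' * (s + dot z y) ^+ 2)))%:E))%E.
  apply: eq_integral => y _.
  transitivity (\int[mu]_t ((expR (- dot y y))%:E *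
      (expR (- (t ^+ 2 + b * ((s + dot z y) + p * t) ^+ 2)))%:E))%E.
    apply: eq_integral => t _; rewrite !dot_cons -EFinM -expRD.
    by congr (expR _)%:E; ring.
  rewrite ge0_integralZl//=; last by meas.
  rewrite integral_gauss_affine// -!EFinM; congr EFin.
  by rewrite mulrCA -expRD -opprD.
rewrite ge0_integralZl//=; last by meas.
rewrite IH// -EFinM; congr EFin.
have E0 : 0 < 1 + b * (p * p + dot z z).
  by rewrite ltr_pwDl// mulr_ge0// addr_ge0// -expr2.
(* The determinant [1 + b |w|^2] of the quadratic form is the pivot [D] of the first coordinate
   times the determinant of the remaining form. *)
have DE : 1 + b * (p * p + dot z z) = D * (1 + b' * dot z z).
  by rewrite /b' /D; field; rewrite -/D gt_eqF.
have F0 : 0 < 1 + b' * dot z z by rewrite ltr_pwDl// mulr_ge0.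
rewrite DE sqrtrM ?(ltW D0)// mulrA; congr (_ * expR (- (_ * _))).
  rewrite /k exprS; field.
  by rewrite !gt_eqF ?sqrtr_gt0.
by rewrite invfM mulrA.
Qed.

Lemma integral_leb_gauss0 n :
  (\int[@leb R n]_x (expR (- dot x x))%:E = (Num.sqrt pi ^+ n)%:E)%E.
Proof.
have := @integral_leb_gauss n [tuple 0 | _ < n] 0 0 (lexx 0).
rewrite !mul0r addr0 sqrtr1 divr1 oppr0 expR0 mulr1 => <-.
by apply: eq_integral => x _; rewrite mul0r addr0.
Qed.

End gauss.

(** * Integration over a hyperplane in graph coordinates *)

Section graph.
Context {R : realType} {m : nat}.
Implicit Types (w x y : m.-tuple R).

Lemma dot_graph w x : dot (graph w x) (graph w x) = dot x x + dot w x ^+ 2.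
Proof. by rewrite /graph dot_cons mulrNN addrC expr2. Qed.

Lemma graph_perp w x : dot (graph w x) (tcons 1 w) = 0.
Proof. by rewrite /graph dot_cons mulr1 dotC addNr. Qed.

Lemma perp_graph w (z : m.+1.-tuple R) :
  dot z (tcons 1 w) = 0 -> z = graph w [tuple of behead z].
Proof.
case/tupleP: z => t y; rewrite -/(tcons t y) dot_cons mulr1 => /eqP.
rewrite addr_eq0 => /eqP ->; rewrite dotC /graph.
have -> : [tuple of behead (tcons (- dot w y) y)] = y by exact/val_inj.
by [].
Qed.

Variables (w : m.-tuple R) (U : m.-tuple (m.+1.-tuple R)).
Hypothesis U_onb : perp_onb (tcons 1 w) U.

Let dot_U i j : dot (tnth U i) (tnth U j) = (i == j)%:R.
Proof. by have [] := U_onb. Qed.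

Let dot_lincomb y (z : m.+1.-tuple R) :
  dot (@lincomb R m.+1 U y) z = \sum_(j < m) tnth y j * dot (tnth U j) z.
Proof.
rewrite /dot; under eq_bigr do rewrite tnth_mktuple mulr_suml.
rewrite exchange_big; apply: eq_bigr => j _; rewrite mulr_sumr.
by apply: eq_bigr => i _; rewrite mulrA.
Qed.

Lemma lincomb_perp y : dot (@lincomb R m.+1 U y) (tcons 1 w) = 0.
Proof.
by rewrite dot_lincomb big1// => j _; have [_ ->] := U_onb; rewrite mulr0.
Qed.

Lemma dot_lincomb_lincomb y :
  dot (@lincomb R m.+1 U y) (@lincomb R m.+1 U y) = dot y y.
Proof.
rewrite dot_lincomb; apply: eq_bigr => j _; congr (_ * _).
rewrite dotC dot_lincomb (bigD1 j)//= dot_U eqxx mulr1 big1 ?addr0// => i ij.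
by rewrite dot_U (negbTE ij) mulr0.
Qed.

Lemma lincombD x y : @lincomb R m.+1 U (tadd x y) =
  tadd (@lincomb R m.+1 U x) (@lincomb R m.+1 U y).
Proof.
apply: eq_from_tnth => i; rewrite !tnth_mktuple -big_split.
by apply: eq_bigr => j _; rewrite tnth_mktuple mulrDl.
Qed.

(* The rows [U_j] and [(1, w) / |(1, w)|] form an orthogonal matrix, whose
   transpose is then orthogonal as well. *)
Lemma lincomb_dot (z : m.+1.-tuple R) : dot z (tcons 1 w) = 0 ->
  @lincomb R m.+1 U [tuple dot (tnth U j) z | j < m] = z.
Proof.
move=> z_perp.
pose xi := tcons 1 w; pose r := Num.sqrt (dot xi xi).
have xi0 : 0 < dot xi xi by rewrite dot_cons mulr1 ltr_pwDl// dot_ge0.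
have r2 : r * r = dot xi xi by rewrite -expr2 sqr_sqrtr// ltW.
have r0 : r != 0 by rewrite gt_eqF// sqrtr_gt0.
pose V (i : 'I_m.+1) a : R :=
  if unlift ord0 i is Some j then tnth (tnth U j) a else tnth xi a / r.
pose M : 'M[R]_m.+1 := \matrix_(i, a) V i a.
have dotr j : \sum_a tnth (tnth U j) a * (tnth xi a / r) = 0.
  under eq_bigr do rewrite mulrA.
  rewrite -mulr_suml; have [_ U0] := U_onb.
  by have := U0 j; rewrite /dot => ->; rewrite mul0r.
have MMT : M *m M^T = 1%:M.
  apply/matrixP => i k; rewrite !mxE; under eq_bigr do rewrite !mxE.
  rewrite /V; case: (unliftP ord0 i) => [j|] ->; case: (unliftP ord0 k) => [l|] ->.
  - by rewrite (inj_eq lift_inj) -dot_U.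
  - by rewrite dotr eq_sym (negbTE (neq_lift _ _)).
  - under eq_bigr do rewrite mulrC.
    by rewrite dotr (negbTE (neq_lift _ _)).
  - under eq_bigr do rewrite mulrACA.
    by rewrite -mulr_suml -invfM r2 -/(dot xi xi) mulfV ?eqxx ?gt_eqF.
have MTM := mulmx1C MMT.
apply: eq_from_tnth => b; rewrite tnth_mktuple.
transitivity (\sum_a tnth z a * (M^T *m M) a b); last first.
  rewrite MTM (bigD1 b)//= big1 ?addr0 => [|a ab].
    by rewrite mxE eqxx mulr1.
  by rewrite !mxE (negbTE ab) mulr0.
under [RHS]eq_bigr do rewrite mxE mulr_sumr.
rewrite exchange_big /= big_ord_recl [X in _ = X + _](_ : _ = 0) ?add0r.
  apply: eq_bigr => j _; rewrite tnth_mktuple dotC /dot mulr_suml.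
  by apply: eq_bigr => a _; rewrite !mxE /V liftK mulrA.
rewrite [RHS](_ : 0 = dot z xi * (r^-1 * V ord0 b)); last first.
  by rewrite z_perp mul0r.
rewrite /dot mulr_suml; apply: eq_bigr => a _.
by rewrite !mxE {1}/V unlift_none !mulrA.
Qed.

(* The quotient of the two integrals is computed with the Gaussian test
   function [exp(- |graph w x| ^ 2)]. *)
Lemma integral_lincomb (f : m.+1.-tuple R -> \bar R) :
  measurable_fun setT f -> (forall z, 0 <= f z)%E ->
  (\int[leb m]_y f (@lincomb R m.+1 U y) =
   (Num.sqrt (1 + dot w w))%:E * \int[leb m]_x f (graph w x))%E.
Proof.
move=> mf f0.
(* [T] passes from basis coordinates on the hyperplane to graph coordinates, and [S] goes back. *)
pose T y := [tuple of behead (@lincomb R m.+1 U y)].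
pose S x := [tuple dot (tnth U j) (graph w x) | j < m].
have TE y : @lincomb R m.+1 U y = graph w (T y).
  by apply: perp_graph; exact: lincomb_perp.
have SE x : @lincomb R m.+1 U (S x) = graph w x.
  by apply: lincomb_dot; exact: graph_perp.
have mT : measurable_fun setT T.
  by apply: measurable_fun_behead; exact: (@measurable_lincomb R m.+1 U).
have TS x y : T (tadd y (S x)) = tadd (T y) x.
  by rewrite /T lincombD behead_tadd SE; congr tadd; apply/val_inj.
(* Written to match [integral_leb_gauss] with [b = 1] and [s = 0]. Since [lincomb U] is an isometry,
   [g] becomes the standard Gaussian in basis coordinates; the two total masses differ by the factor
   [sqrt (1 + |w|^2)]. *)
pose g x := (expR (- (dot x x + 1 * (0 + dot w x) ^+ 2)))%:E.
have gE y : g (topp (T y)) = (expR (- dot y y))%:E.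
  rewrite /g dotNN dotNr -(dot_lincomb_lincomb y) TE dot_graph.
  by congr (expR (- _))%:E; ring.
have mg : measurable_fun setT g by rewrite /g; meas.
have mfg : measurable_fun setT (fun x => f (graph w x)).
  by apply: (measurableT_comp mf (g := graph w)); meas.
have g0 x : (0 <= g x)%E by rewrite lee_fin expR_ge0.
have := integral_leb_equivariant mT TS mfg mg (fun x => f0 (graph w x)) g0.
under eq_integral do rewrite -TE.
under [X in (_ = _ * X)%E -> _]eq_integral do rewrite gE.
rewrite integral_leb_gauss0 integral_leb_gauss// expr0n !mulr0 oppr0 expR0 mulr1.
rewrite mul1r; set p := _ ^+ m; set r := Num.sqrt _ => H.
have p0 : 0 < p by rewrite exprn_gt0// sqrtr_gt0 pi_gt0.
have r0 : 0 < r by rewrite sqrtr_gt0 ltr_pwDl// dot_ge0.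
rewrite -[LHS]mule1 (_ : 1%E = (p / r)%:E * (r / p)%:E)%E; last first.
  by rewrite -EFinM; congr EFin; field; rewrite !gt_eqF.
rewrite muleA H -muleA -EFinM muleC; congr (_%:E * _)%E.
by field; rewrite gt_eqF.
Qed.

End graph.

(** * Consequences for unit normals proportional to [(1, w)] *)

Section radial.
Context {R : realType} {m : nat}.
Implicit Types w : m.-tuple R.

Let normalize w : m.+1.-tuple R :=
  [tuple tnth (tcons 1 w) i / Num.sqrt (1 + dot w w) | i < m.+1].

Let dot_normalize z w :
  dot z (normalize w) = dot z (tcons 1 w) / Num.sqrt (1 + dot w w).
Proof.
by rewrite /dot mulr_suml; apply: eq_bigr => i _; rewrite tnth_mktuple mulrA.
Qed.

Let r_gt0 w : 0 < Num.sqrt (1 + dot w w).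
Proof. by rewrite sqrtr_gt0 ltr_pwDl// dot_ge0. Qed.

Let normalize_usphere w : usphere (normalize w).
Proof.
rewrite /usphere /= /enorm dot_normalize dotC dot_normalize dot_cons mulr1.
rewrite -mulrA -invfM -expr2 sqr_sqrtr; last by rewrite addr_ge0// dot_ge0.
by rewrite mulfV ?sqrtr1// gt_eqF// ltr_pwDl// dot_ge0.
Qed.

Let perp_onb_normalize w : perp_onb (normalize w) = perp_onb (tcons 1 w).
Proof.
apply/seteqP; split => U [UU U0]; split => // i.
- have /eqP := U0 i; rewrite dot_normalize mulf_eq0 invr_eq0.
  by rewrite [X in _ || X]gt_eqF// orbF => /eqP.
- by rewrite dot_normalize U0 mul0r.
Qed.

(** An orthonormal basis of the hyperplane gives an isometry from [R^m], which leaves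
    [psi (dot y y)] unchanged. This replaces rotation invariance: the Gaussian moment of a
    hyperplane does not depend on its normal. *)
Lemma integral_radial (psi : R -> \bar R) w :
  measurable_fun setT psi -> (forall t, 0 <= psi t)%E ->
  (\int[leb m]_y psi (dot y y) =
   (Num.sqrt (1 + dot w w))%:E *
     \int[leb m]_x psi (dot (graph w x) (graph w x)))%E.
Proof.
move=> mpsi psi0.
have [U] := perp_onb_neq0 (ltn0Sn m) (normalize_usphere w).
rewrite perp_onb_normalize => UO.
rewrite -(integral_lincomb UO (f := fun z => psi (dot z z)))//.
  by under [RHS]eq_integral do rewrite (dot_lincomb_lincomb UO).
by apply: (measurableT_comp mpsi (g := fun z => dot z z)); meas.
Qed.

(** Normalizing [(1, w)] does not change the set of orthonormal bases of its orthogonal complement,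
    and [integral_lincomb] holds for any of them, hence for the one that [xget] selects. *)
Lemma integral_leb_perp_graph (q : m.+1.-tuple R -> R) w :
  measurable_fun setT q -> (forall x, 0 <= q x) ->
  exists2 xi : m.+1.-tuple R, usphere xi &
  (\int[leb_perp xi]_(x in perp xi) (q x)%:E =
   (Num.sqrt (1 + dot w w))%:E * \int[leb m]_x (q (graph w x))%:E)%E.
Proof.
move=> mq q0; exists (normalize w) => //.
rewrite /leb_perp; set U := xget _ _.
have UO : perp_onb (tcons 1 w) U.
  rewrite -perp_onb_normalize.
  have [V VO] := perp_onb_neq0 (ltn0Sn m) (normalize_usphere w).
  by apply: xgetPex; exists V.
have mU := @measurable_lincomb R m.+1 U.
rewrite -(integral_lincomb UO (f := fun z => (q z)%:E))//; last by meas.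
have mperp : measurable (perp (normalize w)).
  have mdot : measurable_fun setT (fun x => dot x (normalize w)) by meas.
  by have := mdot measurableT _ (measurable_set1 0); rewrite setTI.
rewrite ge0_integral_pushforward//; last 2 first.
- by apply/measurable_EFinP; exact: measurable_funTS.
- by move=> z _; rewrite lee_fin.
congr (integral _ _ _).
apply/seteqP; split => y //= _.
by rewrite /perp /= dot_normalize lincomb_perp// mul0r.
Qed.

End radial.

(** * Lower bound of order [sqrt n] for the Gaussian mean of the norm *)

Section gauss_moment.
Context {R : realType}.
Local Notation mu := (@lebesgue_measure R).

Definition l1norm n (x : n.-tuple R) : R := \sum_(i < n) `|tnth x i|.

(** Cauchy-Schwarz, by expanding the square of the sum and bounding each [|x_i| |x_j|] by
    [(x_i^2 + x_j^2) / 2]. *)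
Lemma l1norm_le n (x : n.-tuple R) : l1norm x <= Num.sqrt n%:R * Num.sqrt (dot x x).
Proof.
have l0 : 0 <= l1norm x by apply: sumr_ge0.
rewrite -sqrtrM ?ler0n// -[leLHS]ger0_norm// -sqrtr_sqr ler_wsqrtr//.
rewrite expr2 {1 2}/l1norm big_distrlr/=.
apply: (@le_trans _ _ (\sum_(i < n) \sum_(j < n)
    (tnth x i * tnth x i / 2 + tnth x j * tnth x j / 2))).
  apply: ler_sum => i _; apply: ler_sum => j _.
  rewrite -!expr2 -[tnth x i ^+ 2]real_normK ?num_real//.
  rewrite -[tnth x j ^+ 2]real_normK ?num_real//.
  by have := sqr_ge0 (`|tnth x i| - `|tnth x j|); lra.
under eq_bigr do rewrite big_split/= sumr_const card_ord -mulr_suml.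
rewrite big_split/= sumr_const card_ord sumrMnl -mulr_suml -/(dot x x).
by rewrite -mulrnDl -splitr mulr_natl.
Qed.

Lemma l1norm_cons n t (x : n.-tuple R) : l1norm (tcons t x) = `|t| + l1norm x.
Proof.
rewrite /l1norm big_ord_recl tnth0; congr (_ + _).
by apply: eq_bigr => i _; rewrite tnthS.
Qed.

Lemma measurable_l1norm n : measurable_fun setT (@l1norm n).
Proof.
apply: measurable_sum => i.
by apply: (measurableT_comp (@normr_measurable _ setT)); meas.
Qed.

(** A lower bound for [|t| exp(- t^2)] on [[1/2, 1]]; multiplied by the length of that interval it
    gives [j0]. *)
Let e0 : R := expR (- 1) / 2.

Let j0 : R := e0 / 2.

Let e0_gt0 : 0 < e0. Proof. by rewrite divr_gt0// expR_gt0. Qed.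

Let integral_norm_gauss : (j0%:E <= \int[mu]_t (`|t| * gauss_fun t)%:E)%E.
Proof.
have mi : measurable_fun setT (\1_`[2^-1, 1] : R -> R) by exact: measurable_indic.
have -> : j0%:E = (\int[mu]_t (e0%:E * (\1_`[2^-1, 1] t)%:E))%E.
  rewrite ge0_integralZl//=; [|exact/measurable_EFinP|by rewrite lee_fin ltW].
  rewrite integral_indic// setIT /= lebesgue_measure_itv/= lte_fin.
  rewrite ifT; last by lra.
  by rewrite -EFinB -EFinM; congr EFin; rewrite /j0; field.
apply: ge0_le_integral => //=.
- by move=> t _; rewrite -EFinM lee_fin mulr_ge0// ltW.
- by apply: emeasurable_funM => //; exact/measurable_EFinP.
- apply/measurable_EFinP; apply: measurable_funM => //.
  exact: measurable_gauss_fun.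
- move=> t _; rewrite -EFinM lee_fin indicE mem_setE in_itv/=.
  case: (boolP (_ && _)) => [/andP[t0 t1]|_]; last first.
    by rewrite mulr0 mulr_ge0// gauss_fun_ge0.
  rewrite mulr1 mulrC ger0_norm; last by lra.
  apply: ler_pM; rewrite ?expR_ge0//.
  by rewrite ler_expR lerN2; nra.
Qed.

(** A lower bound for the mean of [|t|] under the normalized Gaussian, hence the contribution of
    each coordinate to the mean of [l1norm]. *)
Let kappa : R := j0 / Num.sqrt pi.

Lemma integral_l1norm_gauss n :
  ((n%:R * kappa * Num.sqrt pi ^+ n)%:E <=
   \int[leb n]_x (l1norm x * expR (- dot x x))%:E)%E.
Proof.
have l0 k (x : k.-tuple R) : 0 <= l1norm x by apply: sumr_ge0.
have ml k : measurable_fun setT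
    (fun x : k.-tuple R => (l1norm x * expR (- dot x x))%:E).
  apply/measurable_EFinP; apply: measurable_funM; first exact: measurable_l1norm.
  meas.
have G0 k (x : k.-tuple R) : (0 <= (l1norm x * expR (- dot x x))%:E)%E.
  by rewrite lee_fin mulr_ge0// expR_ge0.
have sp : 0 < Num.sqrt pi :> R by rewrite sqrtr_gt0 pi_gt0.
elim: n => [|n IH]; first by rewrite !mul0r; exact: integral_ge0.
have mN : measurable_fun setT (fun t : R => (`|t| * gauss_fun t)%:E).
  apply/measurable_EFinP; apply: measurable_funM => //.
  exact: measurable_gauss_fun.
have mg : measurable_fun setT (fun t : R => (gauss_fun t)%:E).
  by apply/measurable_EFinP; exact: measurable_gauss_fun.
rewrite integral_leb_cons//.
(* A lower bound for the integral over the first coordinate [t]: the term [|t|] contributes at least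
   [j0], and [l1norm y] is multiplied by the full mass [sqrt pi]. *)
pose F (y : n.-tuple R) := (j0%:E * (expR (- dot y y))%:E +
  (Num.sqrt pi)%:E * (l1norm y * expR (- dot y y))%:E : \bar R)%E.
apply: (@le_trans _ _ (\int[leb n]_y F y)%E).
  rewrite ge0_integralD//=; last 4 first.
  - by move=> x _; rewrite -EFinM lee_fin mulr_ge0 ?expR_ge0// divr_ge0// ltW.
  - by meas.
  - by move=> x _; rewrite mule_ge0// lee_fin ltW.
  - by apply: emeasurable_funM; [exact: measurable_cst|exact: ml].
  rewrite !ge0_integralZl//=; [|exact: ml|by meas|by rewrite lee_fin divr_ge0// ltW].
  rewrite integral_leb_gauss0.
  apply: (@le_trans _ _ (j0%:E * (Num.sqrt pi ^+ n)%:E +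
    (Num.sqrt pi)%:E * (n%:R * kappa * Num.sqrt pi ^+ n)%:E)%E); last first.
    by rewrite leeD2l// lee_wpmul2l// lee_fin ltW.
  rewrite -!EFinM -EFinD lee_fin -natr1 exprS.
  rewrite le_eqVlt; apply/orP; left; apply/eqP; rewrite /kappa; field.
  by rewrite gt_eqF.
apply: ge0_le_integral => //=.
- move=> y _; rewrite adde_ge0// mule_ge0// lee_fin ?expR_ge0// ?divr_ge0// ltW//.
- apply: emeasurable_funD; first by meas.
  by apply: emeasurable_funM; [exact: measurable_cst|exact: ml].
- apply: measurable_fun_integral => //.
  exact: (measurable_fun_cons2 (ml n.+1)).
- move=> y _.
  have -> : (\int[mu]_t
      (l1norm (tcons t y) * expR (- dot (tcons t y) (tcons t y)))%:E =
    \int[mu]_t ((expR (- dot y y))%:E * ((`|t| * gauss_fun t)%:E +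
       (l1norm y)%:E * (gauss_fun t)%:E)))%E.
    apply: eq_integral => t _.
    rewrite l1norm_cons dot_cons -(EFinM (l1norm y)) -EFinD -EFinM.
    by congr EFin; rewrite opprD expRD /gauss_fun expr2; ring.
  have N0 t : (0 <= (`|t| * gauss_fun t)%:E :> \bar R)%E.
    by rewrite lee_fin; apply: mulr_ge0; [exact: normr_ge0|exact: gauss_fun_ge0].
  have L0 t : (0 <= (l1norm y)%:E * (gauss_fun t)%:E :> \bar R)%E.
    by apply: mule_ge0; rewrite lee_fin ?gauss_fun_ge0.
  have mL : measurable_fun setT (fun t : R => (l1norm y)%:E * (gauss_fun t)%:E)%E.
    by apply: emeasurable_funM.
  rewrite ge0_integralZl//=; last 2 first.
  - exact: emeasurable_funD.
  - by move=> t _; rewrite adde_ge0.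
  rewrite ge0_integralD//= ge0_integralZl//=; last 2 first.
  - by move=> t _; rewrite lee_fin gauss_fun_ge0.
  - by rewrite lee_fin l0.
  rewrite integralT_gauss -EFinM.
  rewrite /F -EFinM -EFinM -EFinD.
  apply: (@le_trans _ _
    ((expR (- dot y y))%:E * (j0%:E + (l1norm y * Num.sqrt pi)%:E))%E).
    by rewrite -EFinD -EFinM lee_fin; lra.
  by rewrite lee_wpmul2l ?lee_fin ?expR_ge0// leeD2r.
Qed.

(* [|x|_2] is bounded below by [|x|_1 / sqrt n], whose integral splits over the
   coordinates. *)
Lemma integral_norm_gauss_ge n :
  ((Num.sqrt n%:R * kappa * Num.sqrt pi ^+ n)%:E <=
   \int[leb n]_x (expR (- dot x x) * Num.sqrt (dot x x))%:E)%E.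
Proof.
case: n => [|n].
  rewrite sqrtr0 !mul0r; apply: integral_ge0 => x _.
  by rewrite lee_fin mulr_ge0// expR_ge0.
have n0 : 0 < Num.sqrt n.+1%:R :> R by rewrite sqrtr_gt0 ltr0n.
have mI : measurable_fun setT (fun x : n.+1.-tuple R =>
    (expR (- dot x x) * Num.sqrt (dot x x))%:E).
  by meas.
have I0 (x : n.+1.-tuple R) : (0 <= (expR (- dot x x) * Num.sqrt (dot x x))%:E)%E.
  by rewrite lee_fin mulr_ge0// expR_ge0.
rewrite -(@lee_pmul2l _ (Num.sqrt n.+1%:R)%:E)// -EFinM 2!mulrA -expr2.
rewrite sqr_sqrtr ?ler0n// -ge0_integralZl//.
apply: (le_trans (integral_l1norm_gauss n.+1)).
apply: ge0_le_integral => //.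
- move=> x _; rewrite lee_fin mulr_ge0 ?expR_ge0//; exact: sumr_ge0.
- apply/measurable_EFinP; apply: measurable_funM; first exact: measurable_l1norm.
  by meas.
- by apply: emeasurable_funM.
- move=> x _; rewrite -EFinM lee_fin mulrC mulrCA.
  by rewrite ler_wpM2l ?expR_ge0// l1norm_le.
Qed.

Lemma gauss_moment_const : exists2 k : R, 0 < k & forall n,
  ((Num.sqrt n%:R * k * Num.sqrt pi ^+ n)%:E <=
   \int[leb n]_x (expR (- dot x x) * Num.sqrt (dot x x))%:E)%E.
Proof.
exists kappa; last exact: integral_norm_gauss_ge.
by rewrite /kappa !divr_gt0// sqrtr_gt0 pi_gt0.
Qed.

End gauss_moment.

(** * Pairs of orthogonal vectors in the two coordinate systems *)

Section swap.
Context {R : realType}.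
Local Notation mu := (@lebesgue_measure R).
Local Open Scope ereal_scope.

(** Orthogonal pairs form a null set: with first coordinates [s] and [t], once [s != 0] the equation
    [s t + dot x' y' = 0] leaves a single [t]. In dimension 0 every pair is orthogonal, hence
    [0 < n]. *)
Lemma ge0_eq_integral_dot_neq0 n (F G : n.-tuple R -> n.-tuple R -> \bar R) :
  (0 < n)%N ->
  measurable_fun setT (fun z : n.-tuple R * n.-tuple R => F z.1 z.2) ->
  measurable_fun setT (fun z : n.-tuple R * n.-tuple R => G z.1 z.2) ->
  (forall x y, 0 <= F x y) -> (forall x y, 0 <= G x y) ->
  (forall x y, dot x y != 0%R -> F x y = G x y) ->
  \int[leb n]_x \int[leb n]_y F x y = \int[leb n]_x \int[leb n]_y G x y.
Proof.
case: n F G => // n F G _ mF mG F0 G0 FG.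
have mI H :
    measurable_fun setT (fun z : n.+1.-tuple R * n.+1.-tuple R => H z.1 z.2) ->
    (forall x y, 0 <= H x y) ->
    measurable_fun setT (fun x => \int[leb n.+1]_y H x y).
  by move=> mH H0; exact: measurable_fun_integral.
have I0 (H : n.+1.-tuple R -> n.+1.-tuple R -> \bar R) x :
    (forall x y, 0 <= H x y) -> 0 <= \int[leb n.+1]_y H x y.
  by move=> H0; exact: integral_ge0.
have mr H x :
    measurable_fun setT (fun z : n.+1.-tuple R * n.+1.-tuple R => H z.1 z.2) ->
    measurable_fun setT (H x : _ -> \bar R).
  move=> mH; apply: (measurableT_comp mH (g := fun y => (x, y))).
  exact: measurable_pair1.
rewrite [LHS]integral_leb_cons; [|exact: mI|by move=> x; exact: I0].
rewrite [RHS]integral_leb_cons; [|exact: mI|by move=> x; exact: I0].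
apply: eq_integral => x' _.
have mt : measurable_fun setT (fun s : R => tcons s x') by meas.
apply: (@ge0_eq_integral_off_point _ 0%R).
- exact: (measurableT_comp (mI _ mF F0) mt).
- exact: (measurableT_comp (mI _ mG G0) mt).
- by move=> s; exact: I0.
- by move=> s; exact: I0.
move=> s s0; rewrite [LHS]integral_leb_cons; [|exact: mr|by []].
rewrite [RHS]integral_leb_cons; [|exact: mr|by []].
apply: eq_integral => y' _.
have mt' : measurable_fun setT (fun s : R => tcons s y') by meas.
apply: (@ge0_eq_integral_off_point _ (- dot x' y' / s)%R) => //.
- exact: (measurableT_comp (mr _ _ mF) mt').
- exact: (measurableT_comp (mr _ _ mG) mt').
move=> t tp; apply: FG; rewrite dot_cons; apply: contra tp.
rewrite addr_eq0 => /eqP stE; apply/eqP.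
by rewrite -stE mulrC mulKf.
Qed.

End swap.

Section incidence.
Context {R : realType} {m : nat}.
Local Open Scope ereal_scope.
Variable q : m.+1.-tuple R -> R.

(** On [u^perp], delta(<u, x>) dx is Lebesgue measure divided by [|u|]; the factor [|u|] in the
    weight cancels this. *)
Definition gauss_weight (u x : m.+1.-tuple R) : R :=
  (expR (- dot u u) * Num.sqrt (dot u u) * q x)%R.

(* The measure delta(<u, x>) du dx on pairs of orthogonal vectors, in the
   coordinates obtained by eliminating the first coordinate of x, resp. of u. *)
Definition elim_x (u x : m.-tuple R) (t : R) : \bar R :=
  `|t|^-1%:E * (gauss_weight (tcons t u) (tcons (- dot u x / t) x))%:E.

Definition elim_u (u x : m.-tuple R) (t : R) : \bar R :=
  `|t|^-1%:E * (gauss_weight (tcons (- dot u x / t) u) (tcons t x))%:E.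

Hypothesis mq : measurable_fun setT q.
Hypothesis q0 : forall x, (0 <= q x)%R.

Lemma gauss_weight_ge0 u x : (0 <= gauss_weight u x)%R.
Proof. by rewrite !mulr_ge0// expR_ge0. Qed.

Lemma elim_x_ge0 u x t : 0 <= elim_x u x t.
Proof. by rewrite mule_ge0// lee_fin gauss_weight_ge0. Qed.

Lemma elim_u_ge0 u x t : 0 <= elim_u u x t.
Proof. by rewrite mule_ge0// lee_fin gauss_weight_ge0. Qed.

Lemma measurable_fun_elim_x d (T : measurableType d)
    (f g : T -> m.-tuple R) (h : T -> R) :
  measurable_fun setT f -> measurable_fun setT g -> measurable_fun setT h ->
  measurable_fun setT (fun z => elim_x (f z) (g z) (h z)).
Proof. by move=> mf mg mh; rewrite /elim_x /gauss_weight; meas. Qed.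

Lemma measurable_fun_elim_u d (T : measurableType d)
    (f g : T -> m.-tuple R) (h : T -> R) :
  measurable_fun setT f -> measurable_fun setT g -> measurable_fun setT h ->
  measurable_fun setT (fun z => elim_u (f z) (g z) (h z)).
Proof. by move=> mf mg mh; rewrite /elim_u /gauss_weight; meas. Qed.

End incidence.

Section swap_identity.
Context {R : realType} {m : nat}.
Local Notation mu := (@lebesgue_measure R).
Local Open Scope ereal_scope.
Variable q : m.+1.-tuple R -> R.
Hypothesis mq : measurable_fun setT q.
Hypothesis q0 : forall x, (0 <= q x)%R.

(** For fixed [u] and [x] the two missing first coordinates run over the hyperbola with product
    [c = - dot u x]; each side parametrizes it by one of them. *)
Lemma integral_elim_x_elim_u u x : dot u x != 0%R ->
  \int[mu]_t elim_x q u x t = \int[mu]_t elim_u q u x t.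
Proof.
move=> ux; pose c := (- dot u x)%R.
have c0 : c != 0%R by rewrite oppr_eq0.
pose h t := (gauss_weight q (tcons t u) (tcons (c / t) x))%:E.
have mh : measurable_fun setT h by rewrite /h /gauss_weight; meas.
have h0 t : 0 <= h t by rewrite /h lee_fin gauss_weight_ge0.
rewrite -[LHS](ge0_integral_haar_inv c0 mh h0); apply: eq_integral => t _.
by rewrite /elim_u /h -/c invfM invrK mulrA mulfV// mul1r.
Qed.

(** Tonelli brings the integral over [t] innermost, where the coordinates are exchanged. The
    hyperbola degenerates when [dot u x = 0], which is negligible because [0 < m]; this is where the
    dimension must be at least 2. *)
Lemma integral_elim_swap : (0 < m)%N ->
  \int[leb m]_u \int[mu]_t \int[leb m]_x elim_x q u x t =
  \int[leb m]_x \int[mu]_t \int[leb m]_u elim_u q u x t.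
Proof.
move=> m0; have pX := elim_x_ge0 q0; have pU := elim_u_ge0 q0.
transitivity (\int[leb m]_u \int[leb m]_x \int[mu]_t elim_x q u x t).
  apply: eq_integral => u _; apply: (@ge0_exchange_integral _ _ _ _ _ mu (leb m)).
    exact: (measurable_fun_elim_x mq).
  by move=> t x; exact: pX.
transitivity (\int[leb m]_u \int[leb m]_x \int[mu]_t elim_u q u x t).
  apply: (@ge0_eq_integral_dot_neq0 R m (fun u x => \int[mu]_t elim_x q u x t)
    (fun u x => \int[mu]_t elim_u q u x t)) ; first exact: m0.
  - apply: measurable_fun_integral; last by move=> z t; exact: pX.
    by apply: (measurable_fun_elim_x mq); meas.
  - apply: measurable_fun_integral; last by move=> z t; exact: pU.
    by apply: (measurable_fun_elim_u mq); meas.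
  - by move=> u x; apply: integral_ge0 => t _; exact: pX.
  - by move=> u x; apply: integral_ge0 => t _; exact: pU.
  - exact: integral_elim_x_elim_u.
transitivity (\int[leb m]_x \int[leb m]_u \int[mu]_t elim_u q u x t).
  apply: (@ge0_exchange_integral _ _ _ _ _ (leb m) (leb m)).
    apply: measurable_fun_integral; last by move=> z t; exact: pU.
    by apply: (measurable_fun_elim_u mq); meas.
  by move=> u x; apply: integral_ge0 => t _; exact: pU.
apply: eq_integral => x _; apply: (@ge0_exchange_integral _ _ _ _ _ (leb m) mu).
  exact: (measurable_fun_elim_u mq).
by move=> u t; exact: pU.
Qed.

(** * Upper and lower bounds for the common value *)

Definition gauss_moment n : \bar R :=
  \int[leb n]_x (expR (- dot x x) * Num.sqrt (dot x x))%:E.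

(** For [v = (t, u)] and [w = u / t], the hyperplane orthogonal to [v] is the graph of [w], and
    [|v| / |t| = sqrt (1 + |w|^2)] is exactly its area factor. The integral over [x] is therefore at
    most [c exp(- |v|^2)]. *)
Lemma integral_elim_x_le (c : R) : (0 <= c)%R ->
  (forall w : m.-tuple R, (Num.sqrt (1 + dot w w))%:E *
     \int[leb m]_x (q (graph w x))%:E <= c%:E) ->
  \int[leb m]_u \int[mu]_t \int[leb m]_x elim_x q u x t <=
  (c * Num.sqrt pi ^+ m.+1)%:E.
Proof.
move=> c0 qc; rewrite EFinM -integral_leb_gauss0.
have -> : c%:E * \int[@leb R m.+1]_x (expR (- dot x x))%:E =
    \int[@leb R m.+1]_x (c%:E * (expR (- dot x x))%:E).
  by rewrite ge0_integralZl//; meas.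
rewrite integral_leb_cons; [|by meas|by move=> x; rewrite mule_ge0// lee_fin expR_ge0].
have X0 u t : 0 <= \int[leb m]_x elim_x q u x t.
  by apply: integral_ge0 => x _; exact: elim_x_ge0.
have E0 (v : m.+1.-tuple R) : 0 <= c%:E * (expR (- dot v v))%:E.
  by rewrite mule_ge0// lee_fin expR_ge0.
have mX : measurable_fun setT (fun z : m.-tuple R * measurableTypeR R =>
    \int[leb m]_x elim_x q z.1 x z.2).
  apply: measurable_fun_integral; last by move=> *; exact: elim_x_ge0.
  by apply: (measurable_fun_elim_x mq); meas.
apply: ge0_le_integral.
- exact: measurableT.
- by move=> u _; apply: integral_ge0 => t _; exact: X0.
- by apply: measurable_fun_integral; [exact: mX|move=> u t; exact: X0].
- by apply: measurable_fun_integral; [meas|move=> u t; exact: E0].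
move=> u _; apply: ge0_le_integral.
- exact: measurableT.
- by move=> t _; exact: X0.
- apply: measurable_fun_integral; last by move=> *; exact: elim_x_ge0.
  by apply: (measurable_fun_elim_x mq); meas.
- by meas.
move=> t _.
have [->|t0] := eqVneq t 0%R.
  rewrite integral0_eq; first exact: E0.
  by move=> x _; rewrite /elim_x normr0 invr0 mul0e.
pose w := [tuple t^-1 * tnth u i | i < m]%R.
have wE x : (dot w x = t^-1 * dot u x)%R.
  by rewrite /dot mulr_sumr; apply: eq_bigr => i _; rewrite tnth_mktuple mulrA.
pose v := tcons t u.
have vE : (dot v v = t ^+ 2 * (1 + dot w w))%R.
  rewrite dot_cons wE dotC wE; field.
  exact: t0.
have -> : \int[leb m]_x elim_x q u x t =
    (expR (- dot v v))%:E * ((Num.sqrt (1 + dot w w))%:E *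
      \int[leb m]_x (q (graph w x))%:E).
  rewrite muleA -EFinM.
  transitivity (\int[leb m]_x ((expR (- dot v v) * Num.sqrt (1 + dot w w))%:E *
      (q (graph w x))%:E)); last first.
    by rewrite ge0_integralZl//; [meas|move=> x _; rewrite lee_fin].
  apply: eq_integral => x _; rewrite /elim_x /gauss_weight -/v -!EFinM.
  rewrite /graph (wE x) mulNr [(dot u x / t)%R]mulrC; congr EFin.
  rewrite vE sqrtrM ?sqr_ge0// sqrtr_sqr; field.
  by rewrite normr_eq0.
by rewrite muleC lee_wpmul2r// lee_fin expR_ge0.
Qed.

(** For [z = (t, x)] and [w = x / t], the integral over [u] equals [|t|^-1 q(z)] times
    [gauss_moment m / sqrt (1 + |w|^2)], that is, [q(z) gauss_moment m / |z|]; on the ball [1 / |z|]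
    is at least [1 / r]. *)
Lemma integral_elim_u_ge (r : R) : (0 < r)%R ->
  gauss_moment m * \int[leb m.+1]_(x in eball r) (q x)%:E <=
  r%:E * \int[leb m]_x \int[mu]_t \int[leb m]_u elim_u q u x t.
Proof.
move=> r0.
have gm0 : 0 <= gauss_moment m.
  by apply: integral_ge0 => x _; rewrite lee_fin mulr_ge0// expR_ge0.
have mball : measurable (@eball R m.+1 r).
  have mE : measurable_fun setT
    (fun x : m.+1.-tuple R => Num.sqrt (dot x x)) by meas.
  have -> : @eball R m.+1 r =
      (fun x => Num.sqrt (dot x x)) @^-1` [set` `]-oo, r]].
    by apply/seteqP; split => x; rewrite /eball /enorm /= in_itv.
  by have := mE measurableT _ (measurable_itv `]-oo, r]); rewrite setTI.
pose g (x : m.+1.-tuple R) : R := (q x * \1_(eball r) x)%R.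
have mg : measurable_fun setT g.
  by apply: measurable_funM => //; exact: measurable_indic.
have g0 x : (0 <= g x)%R by rewrite mulr_ge0.
have -> : \int[leb m.+1]_(x in eball r) (q x)%:E = \int[leb m.+1]_x (g x)%:E.
  rewrite integral_mkcond; apply: eq_integral => x _.
  by rewrite patchE /g indicE; case: ifPn => _; rewrite ?mulr1 ?mulr0.
have U0 x t : 0 <= \int[leb m]_u elim_u q u x t.
  by apply: integral_ge0 => u _; exact: elim_u_ge0.
have mU : measurable_fun setT (fun z : m.-tuple R * measurableTypeR R =>
    \int[leb m]_u elim_u q u z.1 z.2).
  apply: measurable_fun_integral; last by move=> *; exact: elim_u_ge0.
  by apply: (measurable_fun_elim_u mq); meas.
have mUx x : measurable_fun setT
    (fun t : measurableTypeR R => \int[leb m]_u elim_u q u x t).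
  apply: measurable_fun_integral; last by move=> *; exact: elim_u_ge0.
  by apply: (measurable_fun_elim_u mq); meas.
have mUt : measurable_fun setT
    (fun x : m.-tuple R => \int[mu]_t \int[leb m]_u elim_u q u x t).
  by apply: measurable_fun_integral; [exact: mU|move=> x t; exact: U0].
have r_ge0 : 0 <= r%:E by rewrite lee_fin ltW.
have gg0 x : 0 <= gauss_moment m * (g x)%:E by rewrite mule_ge0// lee_fin g0.
have mgg : measurable_fun setT (fun x => gauss_moment m * (g x)%:E) by meas.
have -> : gauss_moment m * \int[leb m.+1]_x (g x)%:E =
    \int[leb m.+1]_x (gauss_moment m * (g x)%:E).
  by rewrite (ge0_integralZl _ measurableT)//; [meas|move=> x _; rewrite lee_fin g0].
have -> : r%:E * \int[leb m]_x \int[mu]_t \int[leb m]_u elim_u q u x t =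
    \int[leb m]_x (r%:E * \int[mu]_t \int[leb m]_u elim_u q u x t).
  by rewrite ge0_integralZl// => x _; apply: integral_ge0 => t _; exact: U0.
rewrite integral_leb_cons; [|exact: mgg|exact: gg0].
apply: ge0_le_integral.
- exact: measurableT.
- by move=> x _; apply: integral_ge0 => t _; exact: gg0.
- apply: measurable_fun_integral; last by move=> x t; exact: gg0.
  by meas.
- by apply: emeasurable_funM.
move=> x _.
have -> : r%:E * \int[mu]_t \int[leb m]_u elim_u q u x t =
    \int[mu]_t (r%:E * \int[leb m]_u elim_u q u x t).
  by rewrite ge0_integralZl// => t _; exact: U0.
(* The factor [|t|^-1 * |t|] is 1 except at [t = 0], where it is 0 as [elim_u] is, so that the
   comparison holds at every point. *)
pose G t := gauss_moment m * (`|t|^-1 * `|t| * g (tcons t x))%:E.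
have mG : measurable_fun setT G by rewrite /G; meas.
have G0 t : 0 <= G t by rewrite mule_ge0// lee_fin !mulr_ge0.
rewrite (@ge0_eq_integral_off_point _ 0%R _ G); last 5 first.
- by meas.
- exact: mG.
- by move=> t; exact: gg0.
- exact: G0.
- by move=> t t0; rewrite /G mulVf ?mul1r// normr_eq0.
apply: ge0_le_integral.
- exact: measurableT.
- by move=> t _; exact: G0.
- exact: mG.
- by apply: emeasurable_funM.
rewrite /G.
move=> t _.
have [->|t0] := eqVneq t 0%R.
  by rewrite normr0 invr0 !mul0r mule0 mule_ge0// lee_fin ltW.
rewrite mulVf ?normr_eq0// mul1r.
pose w := [tuple t^-1 * tnth x i | i < m]%R.
have wE u : (dot w u = t^-1 * dot u x)%R.
  by rewrite dotC /dot mulr_sumr; apply: eq_bigr => i _; rewrite tnth_mktuple mulrCA.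
pose psi (s : R) : \bar R := (expR (- s) * Num.sqrt s)%:E.
have psi0 s : 0 <= psi s by rewrite lee_fin mulr_ge0// expR_ge0.
have mpsi : measurable_fun setT psi by rewrite /psi; meas.
have -> : gauss_moment m = (Num.sqrt (1 + dot w w))%:E *
     \int[leb m]_u psi (dot (graph w u) (graph w u)).
  exact: integral_radial.
set I := \int[leb m]_u psi _.
have -> : \int[leb m]_u elim_u q u x t = (`|t|^-1 * q (tcons t x))%:E * I.
  transitivity (\int[leb m]_u ((`|t|^-1 * q (tcons t x))%:E *
      psi (dot (graph w u) (graph w u)))); last first.
    rewrite ge0_integralZl//; last by rewrite lee_fin mulr_ge0.
    by rewrite /psi; meas.
  apply: eq_integral => u _; rewrite /elim_u /gauss_weight -!EFinM.
  by rewrite /graph (wE u) mulNr [(dot u x / t)%R]mulrC; congr EFin; ring.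
rewrite muleAC -EFinM muleA -EFinM; apply: lee_wpmul2r.
  by apply: integral_ge0.
rewrite lee_fin /g indicE; have [xr|_] := boolP (_ \in _); last first.
  by rewrite !mulr0 !mulr_ge0// ltW.
rewrite mulr1 mulrA ler_wpM2r// ler_pdivlMr ?normr_gt0//.
move: xr; rewrite inE /eball /= /enorm dot_cons; apply: le_trans.
rewrite -sqrtr_sqr -sqrtrM; last by rewrite addr_ge0// dot_ge0.
rewrite ler_wsqrtr// le_eqVlt; apply/orP; left; apply/eqP.
rewrite !wE; field.
exact: t0.
Qed.

Lemma gauss_moment_eball (c r : R) : (0 < m)%N -> (0 <= c)%R -> (0 < r)%R ->
  (forall w : m.-tuple R, (Num.sqrt (1 + dot w w))%:E *
     \int[leb m]_x (q (graph w x))%:E <= c%:E) ->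
  gauss_moment m * \int[leb m.+1]_(x in eball r) (q x)%:E <=
  (r * (c * Num.sqrt pi ^+ m.+1))%:E.
Proof.
move=> m0 c0 r0 qc; apply: (le_trans (integral_elim_u_ge r0)).
rewrite EFinM; apply: lee_wpmul2l; first by rewrite lee_fin ltW.
by rewrite -integral_elim_swap//; exact: integral_elim_x_le.
Qed.

End swap_identity.

(** * Conclusion and choice of the constant *)

Theorem lemma6p2 (R : realType) :
  exists C : R, 0 < C /\
    forall (n : nat) (q : n.-tuple R -> R) (a : R),
      (2 <= n)%N ->
      (forall x : n.-tuple R, 0 <= q x) ->
      measurable_fun setT q ->
      (leb n).-integrable setT (EFin \o q) ->
      (forall xi : n.-tuple R, usphere xi ->
        (\int[leb_perp xi]_(x in perp xi) (q x)%:E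
           <= (a / Num.sqrt n%:R)%:E)%E) ->
      forall r : R, 0 < r ->
        (\int[leb n]_(x in eball r) (q x)%:E <= (C * (a * r / n%:R))%:E)%E.
Proof.
have [k k0 kP] := @gauss_moment_const R.
pose p : R := Num.sqrt pi; have p0 : 0 < p by rewrite sqrtr_gt0 pi_gt0.
(* With [n = m + 1], the factor [p] is the quotient of the Gaussian masses in dimensions [m + 1] and
   [m], [k] comes from the moment bound, and [sqrt 2] from [sqrt (m + 1) <= sqrt 2 * sqrt m]. *)
exists (Num.sqrt 2 * p / k); split.
  by rewrite divr_gt0// mulr_gt0// sqrtr_gt0.
case=> [//|m] q a m1 q0 mq _ qa r r0.
have n0 : 0 < Num.sqrt m.+1%:R :> R by rewrite sqrtr_gt0 ltr0n.
have m0 : 0 < Num.sqrt m%:R :> R by rewrite sqrtr_gt0 ltr0n.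
pose c := a / Num.sqrt m.+1%:R.
have graph_le w : ((Num.sqrt (1 + dot w w))%:E *
    \int[leb m]_x (q (graph w x))%:E <= c%:E)%E.
  have [xi xi1 <-] := integral_leb_perp_graph w mq q0.
  exact: qa.
(* The sign of [a] is not assumed: it follows from the bound on one hyperplane, since [q] is
   nonnegative. *)
have c0 : 0 <= c.
  rewrite -lee_fin; apply: le_trans (graph_le [tuple 0 | _ < m]).
  rewrite mule_ge0 ?lee_fin//.
  by apply: integral_ge0 => x _; rewrite lee_fin.
have := gauss_moment_eball mq q0 m1 c0 r0 graph_le.
set I := (\int[_]_(x in _) _)%E => le_I.
have I0 : (0 <= I)%E by apply: integral_ge0 => x _; rewrite lee_fin.
pose D := Num.sqrt m%:R * k * p ^+ m.
have D0 : 0 < D by rewrite !mulr_gt0// exprn_gt0.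
(* [D] is the lower bound for [gauss_moment m]; multiplying by it avoids a division in the extended
   reals. *)
rewrite -(@lee_pmul2l _ D%:E)// -EFinM.
apply: (le_trans (lee_wpmul2r I0 (kP m))); apply: (le_trans le_I).
have aE : a = c * Num.sqrt m.+1%:R by rewrite /c divfK// gt_eqF.
have nE : m.+1%:R = Num.sqrt m.+1%:R * Num.sqrt m.+1%:R :> R.
  by rewrite -expr2 sqr_sqrtr.
have le_n : Num.sqrt m.+1%:R <= Num.sqrt 2 * Num.sqrt m%:R :> R.
  rewrite -sqrtrM// ler_wsqrtr// -natrM ler_nat mul2n -addnn -addn1.
  by rewrite leq_add2l.
rewrite lee_fin -/p [in leRHS]aE; move: n0 aE nE le_n.
set s := Num.sqrt m.+1%:R => n0 aE -> le_n.
have -> : D * (Num.sqrt 2 * p / k * (c * s * r / (s * s))) =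
    r * (c * p ^+ m.+1) * (Num.sqrt 2 * Num.sqrt m%:R / s).
  by rewrite /D exprS; field; rewrite !gt_eqF.
have rcp0 : 0 <= r * (c * p ^+ m.+1).
  by apply: mulr_ge0; [exact: ltW|apply: mulr_ge0 => //; exact/exprn_ge0/ltW].
by apply: ler_peMr; rewrite // ler_pdivlMr// mul1r.
Qed.
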